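(* The Weihrauch problem $\mathsf{P}$ of finding a connected component of a countable graph is strongly Weihrauch equivalent to its binary parallelization $\langle\mathsf{P},\mathsf{P}\rangle$.
   Context: A Weihrauch problem is a set $\mathsf{C}\subseteq 2^\omega\times 2^\omega$ of instance/solution pairs. $\mathsf{Q}\le_{\mathrm{sW}}\mathsf{R}$ (strong Weihrauch reducibility) means there are Turing functionals $\Phi,\Psi$ such that for every instance $A$ of $\mathsf{Q}$, $\Phi(A)$ is an instance of $\mathsf{R}$ and for every solution $T$ of $\Phi(A)$, $\Psi(T)$ is a solution of $A$; equivalence means reducibility both ways. $\mathsf{P}$: an instance is a countable graph $(V,E)$ ($V$ a nonempty infinite subset of $\mathbb{N}$, $E$ a set of unordered pairs from $V$); a solution is a connected component, i.e. a set $C\subseteq V$ any two elements of which are joined by a finite path and such that if $x\in C$ and $y$ is path connected to $x$ then $y\in C$. $\langle\mathsf{P},\mathsf{P}\rangle$: an instance is a pair of countable graphs $(G_1,G_2)$, a solution is a pair $(C_1,C_2)$ with $C_i$ a connected component of $G_i$. *)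

(* Defs.v *)
From Stdlib Require Import Arith List Cantor.
Import ListNotations.

Definition cantor := nat -> bool.

(** * Turing functionals

    Partial recursive functions relative to an oracle in [cantor].  Arities are
    not tracked: a code applied to a list of the wrong length is either
    undefined or ignores the extra arguments. *)

Inductive code : Type :=
| Zero
| Succ
| Proj (i : nat)
| Oracle
| Comp (f : code) (gs : list code)
| PrimRec (f g : code)
| Min (f : code).

(** [eval A e xs y]: the computation of [e] with oracle [A] on input [xs]
    halts with output [y]. *)
Inductive eval (A : cantor) : code -> list nat -> nat -> Prop :=
| eval_Zero xs : eval A Zero xs 0
| eval_Succ x xs : eval A Succ (x :: xs) (S x)
| eval_Proj i xs x : nth_error xs i = Some x -> eval A (Proj i) xs x
| eval_Oracle x xs : eval A Oracle (x :: xs) (Nat.b2n (A x))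
| eval_Comp f gs xs ys z :
    Forall2 (fun g y => eval A g xs y) gs ys ->
    eval A f ys z ->
    eval A (Comp f gs) xs z
| eval_PrimRec_0 f g xs y :
    eval A f xs y ->
    eval A (PrimRec f g) (0 :: xs) y
| eval_PrimRec_S f g n xs y z :
    eval A (PrimRec f g) (n :: xs) y ->
    eval A g (n :: y :: xs) z ->
    eval A (PrimRec f g) (S n :: xs) z
| eval_Min f xs n :
    eval A f (n :: xs) 0 ->
    (forall m, m < n -> exists k, eval A f (m :: xs) (S k)) ->
    eval A (Min f) xs n.

(** [maps e A B]: the Turing functional with code [e] is defined at [A], with
    value [B]. *)
Definition maps (e : code) (A B : cantor) : Prop :=
  forall n, eval A e [n] (Nat.b2n (B n)).

Fixpoint eval_functional (A : cantor) (e : code) {struct e} :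
  forall xs y z, eval A e xs y -> eval A e xs z -> y = z.
Proof.
  destruct e as [| |i| |f gs|f g|f]; intros xs y z Hy Hz.
  1-4: inversion Hy; inversion Hz; subst; congruence.
  - inversion Hy as [| | | |? ? ? ys ? Hgs Hf| | |]; subst.
    inversion Hz as [| | | |? ? ? zs ? Hgs' Hf'| | |]; subst.
    assert (E : ys = zs).
    { clear Hf Hf' Hy Hz.
      revert ys zs Hgs Hgs'; induction gs as [|g gs IH]; intros ys zs H H'.
      - inversion H; inversion H'; reflexivity.
      - inversion H; inversion H'; subst; f_equal.
        + eapply eval_functional; eassumption.
        + apply IH; assumption. }
    subst; eapply eval_functional; eassumption.
  - destruct xs as [|n xs]; [inversion Hy|].
    revert y z Hy Hz; induction n as [|n IH]; intros y z Hy Hz;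
      inversion Hy; inversion Hz; subst.
    + eapply eval_functional; eassumption.
    + match goal with
      | H : eval A (PrimRec _ _) _ ?u, H' : eval A (PrimRec _ _) _ ?v,
        K : eval A g (_ :: ?u :: _) _, K' : eval A g (_ :: ?v :: _) _ |- _ =>
          tryif constr_eq u v then fail else
          (pose proof (IH _ _ H H'); subst)
      end.
      eapply eval_functional; eassumption.
  - inversion Hy as [| | | | | | |? ? ? H0 Hlt]; subst.
    inversion Hz as [| | | | | | |? ? ? H0' Hlt']; subst.
    destruct (Nat.lt_trichotomy y z) as [L|[E|L]]; [|exact E|].
    + destruct (Hlt' _ L) as [k Hk].
      discriminate (eval_functional A f _ _ _ H0 Hk).
    + destruct (Hlt _ L) as [k Hk].
      discriminate (eval_functional A f _ _ _ H0' Hk).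
Qed.

Lemma maps_functional (e : code) (A B B' : cantor) :
  maps e A B -> maps e A B' -> forall n, B n = B' n.
Proof.
  intros H H' n.
  generalize (eval_functional _ _ _ _ _ (H n) (H' n)).
  destruct (B n), (B' n); simpl; congruence.
Qed.

(** * Weihrauch problems *)

Definition problem := cantor -> cantor -> Prop.

Definition instance (Q : problem) (A : cantor) : Prop := exists T, Q A T.

Definition sW_le (Q R : problem) : Prop :=
  exists phi psi : code,
    forall A, instance Q A ->
      exists B, maps phi A B /\ instance R B /\
        forall T, R B T -> exists S, maps psi T S /\ Q A S.

Definition sW_equiv (Q R : problem) : Prop := sW_le Q R /\ sW_le R Q.

(** An element [A] of [cantor] codes the pair [(left_part A, right_part A)]. *)
Definition left_part (A : cantor) : cantor := fun n => A (2 * n).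
Definition right_part (A : cantor) : cantor := fun n => A (2 * n + 1).

Definition parallel (Q R : problem) : problem := fun A T =>
  Q (left_part A) (left_part T) /\ R (right_part A) (right_part T).

(** * Connected components of countable graphs

    [G] codes the pair [(V, E)]; the unordered pair [{x, y}] with [x < y] is
    represented in [E] by the Cantor code of [(x, y)]. *)

Definition vertex (G : cantor) (x : nat) : Prop := left_part G x = true.

Definition edge_code (G : cantor) (x y : nat) : Prop :=
  right_part G (Cantor.to_nat (x, y)) = true.

Definition adjacent (G : cantor) (x y : nat) : Prop :=
  edge_code G x y \/ edge_code G y x.

Definition is_graph (G : cantor) : Prop :=
  (forall n, exists x, n <= x /\ vertex G x) /\
  (forall x y, edge_code G x y -> x < y /\ vertex G x /\ vertex G y).

Definition path_connected (G : cantor) (x y : nat) : Prop :=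
  exists (k : nat) (p : nat -> nat),
    p 0 = x /\ p k = y /\ forall i, i < k -> adjacent G (p i) (p (S i)).

(** Nonemptiness matters: the empty set would be a computable solution of
    every instance. *)
Definition is_component (G C : cantor) : Prop :=
  (exists x, C x = true) /\
  (forall x, C x = true -> vertex G x) /\
  (forall x y, C x = true -> C y = true -> path_connected G x y) /\
  (forall x y, C x = true -> path_connected G x y -> C y = true).

Definition P : problem := fun G C => is_graph G /\ is_component G C.

(* Main.v *)
(** Reducing the pair to [P]: the Cartesian product of [G1] and [G2] (move along an edge in
    one coordinate, keep the other one fixed) has exactly the products [C1 x C2] of components
    as its components.  From the set [C1 x C2] alone one finds its least element
    [(x0, y0)], and then recovers [C1] and [C2] as the sections through [y0] and [x0]. *)

From Stdlib Require Import Arith List Cantor Lia Bool Relations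
  FunctionalExtensionality.
Require Import Defs.
Import ListNotations.

(** * Computable functions relative to an oracle *)

(** One code serves all oracles, which is the uniformity that a functional requires. Arguments are
    read off as [nth i xs 0]; the default 0 is harmless for [i < k], since lists have length [k]. *)
Definition computes (k : nat) (f : cantor -> list nat -> nat) : Prop :=
  exists e, forall A xs, length xs = k -> eval A e xs (f A xs).

Definition computes1 (h : nat -> nat) : Prop :=
  computes 1 (fun _ xs => h (nth 0 xs 0)).

Definition computes2 (h : nat -> nat -> nat) : Prop :=
  computes 2 (fun _ xs => h (nth 0 xs 0) (nth 1 xs 0)).

Lemma computes_maps (F : cantor -> cantor) :
  computes 1 (fun A xs => Nat.b2n (F A (nth 0 xs 0))) ->
  exists e, forall A, maps e A (F A).
Proof. intros [e He]; exists e; intros A n; exact (He A [n] eq_refl). Qed.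

Lemma computes_ext k f g :
  computes k f ->
  (forall A xs, length xs = k -> f A xs = g A xs) ->
  computes k g.
Proof.
  intros [e He] E; exists e; intros A xs Hxs.
  rewrite <- E by assumption; auto.
Qed.

Lemma computes_nth k i : i < k -> computes k (fun _ xs => nth i xs 0).
Proof.
  intros Hi; exists (Proj i); intros A xs Hxs.
  apply eval_Proj, nth_error_nth'; lia.
Qed.

Lemma computes_lift1 k h f :
  computes1 h -> computes k f -> computes k (fun A xs => h (f A xs)).
Proof.
  intros [e He] [d Hd]; exists (Comp e [d]); intros A xs Hxs.
  apply eval_Comp with [f A xs].
  - repeat constructor; auto.
  - exact (He A [f A xs] eq_refl).
Qed.

Lemma computes_lift2 k h f g :
  computes2 h -> computes k f -> computes k g ->
  computes k (fun A xs => h (f A xs) (g A xs)).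
Proof.
  intros [e He] [d Hd] [c Hc]; exists (Comp e [d; c]); intros A xs Hxs.
  apply eval_Comp with [f A xs; g A xs].
  - repeat constructor; auto.
  - exact (He A [f A xs; g A xs] eq_refl).
Qed.

Lemma computes_S k f : computes k f -> computes k (fun A xs => S (f A xs)).
Proof.
  apply (computes_lift1 k S).
  exists Succ; intros A [|x [|]] Hxs; try discriminate; constructor.
Qed.

Lemma computes_const k n : computes k (fun _ _ => n).
Proof.
  induction n as [|n IH].
  - exists Zero; constructor.
  - apply computes_S, IH.
Qed.

Lemma computes_oracle k f :
  computes k f -> computes k (fun A xs => Nat.b2n (A (f A xs))).
Proof.
  intros [d Hd]; exists (Comp Oracle [d]); intros A xs Hxs.
  apply eval_Comp with [f A xs]; repeat constructor; auto.
Qed.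

Lemma computes_rec1 h s :
  computes2 s -> (forall n, h (S n) = s n (h n)) -> computes1 h.
Proof.
  intros [e He] E.
  destruct (computes_const 0 (h 0)) as [d Hd].
  exists (PrimRec d e); intros A [|n [|]] Hxs; try discriminate; simpl; clear Hxs.
  induction n as [|n IH].
  - constructor; exact (Hd A [] eq_refl).
  - apply eval_PrimRec_S with (h n); [exact IH|].
    rewrite E.
    exact (He A [n; h n] eq_refl).
Qed.

(** Recursion runs on the first argument; [s] takes the counter, the previous value and the
    parameter in the order used by [eval_PrimRec_S]. *)
Lemma computes_rec2 h s :
  computes1 (h 0) ->
  computes 3 (fun _ xs => s (nth 0 xs 0) (nth 1 xs 0) (nth 2 xs 0)) ->
  (forall n x, h (S n) x = s n (h n x) x) -> computes2 h.
Proof.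
  intros [d Hd] [e He] E.
  exists (PrimRec d e); intros A [|n [|x [|]]] Hxs; try discriminate; simpl; clear Hxs.
  induction n as [|n IH].
  - constructor; exact (Hd A [x] eq_refl).
  - apply eval_PrimRec_S with (h n x); [exact IH|].
    rewrite E; exact (He A [n; h n x; x] eq_refl).
Qed.

(** The total function [h] is given beforehand and only has to be the first zero of [f]; this makes
    the search halt on every input. *)
Lemma computes_min k f h :
  computes (S k) f ->
  (forall A xs, length xs = k ->
    f A (h A xs :: xs) = 0 /\ forall m, m < h A xs -> f A (m :: xs) <> 0) ->
  computes k h.
Proof.
  intros [e He] H; exists (Min e); intros A xs Hxs.
  destruct (H A xs Hxs) as [H0 Hlt].
  constructor.
  - rewrite <- H0; apply He; simpl; auto.
  (* [eval_Min] wants the values before the zero displayed as successors. *)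
  - intros m Hm; exists (pred (f A (m :: xs))).
    rewrite Nat.succ_pred by (apply Hlt, Hm).
    apply He; simpl; auto.
Qed.

(** * Arithmetic and Boolean operations *)

Lemma computes_add k f g :
  computes k f -> computes k g -> computes k (fun A xs => f A xs + g A xs).
Proof.
  apply (computes_lift2 k Nat.add).
  apply computes_rec2 with (fun _ y _ => S y).
  - apply computes_nth; lia.
  - apply computes_S, computes_nth; lia.
  - reflexivity.
Qed.

Lemma computes_double k f :
  computes k f -> computes k (fun A xs => 2 * f A xs).
Proof.
  intros Hf; apply computes_ext with (fun A xs => f A xs + f A xs).
  - apply computes_add; exact Hf.
  - intros; lia.
Qed.

Lemma computes_sub k f g :
  computes k f -> computes k g -> computes k (fun A xs => f A xs - g A xs).
Proof.
  (* The subtrahend goes first because it is the recursion variable: [x - S n = pred (x - n)]. *)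
  intros Hf Hg; apply (computes_lift2 k (fun y x => x - y)); trivial.
  apply computes_rec2 with (fun _ z _ => pred z).
  - apply computes_ext with (fun _ xs => nth 0 xs 0).
    + apply computes_nth; lia.
    + intros; lia.
  - apply (computes_lift1 3 pred); [|apply computes_nth; lia].
    apply computes_rec1 with (fun n _ => n).
    + apply computes_nth; lia.
    + reflexivity.
  - intros; lia.
Qed.

Lemma computes_negb k f :
  computes k (fun A xs => Nat.b2n (f A xs)) ->
  computes k (fun A xs => Nat.b2n (negb (f A xs))).
Proof.
  intros Hf; apply computes_ext with (fun A xs => 1 - Nat.b2n (f A xs)).
  - apply computes_sub; [apply computes_const|exact Hf].
  - intros A xs _; destruct (f A xs); reflexivity.
Qed.

(** On values 0 and 1, the conjunction of [a] and [b] is the truncated difference of [a] and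
    [1 - b]. *)
Lemma computes_andb k f g :
  computes k (fun A xs => Nat.b2n (f A xs)) ->
  computes k (fun A xs => Nat.b2n (g A xs)) ->
  computes k (fun A xs => Nat.b2n (f A xs && g A xs)).
Proof.
  intros Hf Hg.
  apply computes_ext with (fun A xs => Nat.b2n (f A xs) - Nat.b2n (negb (g A xs))).
  - apply computes_sub; [|apply computes_negb]; assumption.
  - intros A xs _; destruct (f A xs), (g A xs); reflexivity.
Qed.

Lemma computes_orb k f g :
  computes k (fun A xs => Nat.b2n (f A xs)) ->
  computes k (fun A xs => Nat.b2n (g A xs)) ->
  computes k (fun A xs => Nat.b2n (f A xs || g A xs)).
Proof.
  intros Hf Hg.
  apply computes_ext with (fun A xs => Nat.b2n (negb (negb (f A xs) && negb (g A xs)))).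
  - apply computes_negb, computes_andb; apply computes_negb; assumption.
  - intros A xs _; destruct (f A xs), (g A xs); reflexivity.
Qed.

Lemma computes_if k b f g :
  computes k (fun A xs => Nat.b2n (b A xs)) ->
  computes k (fun A xs => Nat.b2n (f A xs)) ->
  computes k (fun A xs => Nat.b2n (g A xs)) ->
  computes k (fun A xs => Nat.b2n (if b A xs then f A xs else g A xs)).
Proof.
  intros Hb Hf Hg.
  apply computes_ext with
    (fun A xs => Nat.b2n (b A xs && f A xs || negb (b A xs) && g A xs)).
  - apply computes_orb; apply computes_andb; try apply computes_negb; assumption.
  - intros A xs _; destruct (b A xs), (f A xs), (g A xs); reflexivity.
Qed.

(** Truncated subtraction gives 0 exactly when the inequality holds. *)
Lemma computes_leb k f g :
  computes k f -> computes k g ->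
  computes k (fun A xs => Nat.b2n (f A xs <=? g A xs)).
Proof.
  intros Hf Hg; apply computes_ext with (fun A xs => 1 - (f A xs - g A xs)).
  - repeat apply computes_sub; trivial; apply computes_const.
  - intros A xs _; destruct (Nat.leb_spec (f A xs) (g A xs)); simpl Nat.b2n; lia.
Qed.

Lemma computes_ltb k f g :
  computes k f -> computes k g ->
  computes k (fun A xs => Nat.b2n (f A xs <? g A xs)).
Proof.
  intros Hf Hg; apply (computes_leb k (fun A xs => S (f A xs))); trivial.
  apply computes_S, Hf.
Qed.

Lemma computes_eqb k f g :
  computes k f -> computes k g ->
  computes k (fun A xs => Nat.b2n (f A xs =? g A xs)).
Proof.
  intros Hf Hg.
  apply computes_ext with
    (fun A xs => Nat.b2n ((f A xs <=? g A xs) && (g A xs <=? f A xs))).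
  - apply computes_andb; apply computes_leb; assumption.
  - intros A xs _.
    destruct (Nat.leb_spec (f A xs) (g A xs)), (Nat.leb_spec (g A xs) (f A xs)),
      (Nat.eqb_spec (f A xs) (g A xs)); simpl; lia.
Qed.

Lemma computes_odd k f :
  computes k f -> computes k (fun A xs => Nat.b2n (Nat.odd (f A xs))).
Proof.
  apply (computes_lift1 k (fun n => Nat.b2n (Nat.odd n))).
  apply computes_rec1 with (fun _ y => 1 - y).
  - apply computes_sub; [apply computes_const|apply computes_nth; lia].
  - intros n; rewrite Nat.odd_succ, <- Nat.negb_odd; destruct (Nat.odd n); reflexivity.
Qed.

(** Passing from [n] to [S n] raises the half by one exactly when [n] is odd. *)
Lemma computes_div2 k f :
  computes k f -> computes k (fun A xs => Nat.div2 (f A xs)).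
Proof.
  apply (computes_lift1 k Nat.div2).
  apply computes_rec1 with (fun n y => y + Nat.b2n (Nat.odd n)).
  - apply computes_add; [|apply computes_odd]; apply computes_nth; lia.
  - intros n.
    pose proof (Nat.div2_odd n) as E; pose proof (Nat.div2_odd (S n)) as E'.
    rewrite Nat.odd_succ, <- Nat.negb_odd in E'.
    destruct (Nat.odd n); simpl Nat.b2n in *; lia.
Qed.

(** * The Cantor pairing *)

Definition pfst (n : nat) : nat := fst (Cantor.of_nat n).
Definition psnd (n : nat) : nat := snd (Cantor.of_nat n).
Definition pair (x y : nat) : nat := Cantor.to_nat (x, y).

Lemma pfst_pair x y : pfst (pair x y) = x.
Proof. unfold pfst, pair; now rewrite Cantor.cancel_of_to. Qed.

Lemma psnd_pair x y : psnd (pair x y) = y.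
Proof. unfold psnd, pair; now rewrite Cantor.cancel_of_to. Qed.

Lemma pair_eta n : pair (pfst n) (psnd n) = n.
Proof.
  unfold pair, pfst, psnd; rewrite <- surjective_pairing; apply Cantor.cancel_to_of.
Qed.

(** This is the recursion inside [Cantor.to_nat], so [pair_triangle] holds by conversion once the
    sum is commuted. *)
Fixpoint triangle (n : nat) : nat :=
  match n with 0 => 0 | S m => S m + triangle m end.

Lemma triangle_le m n : m <= n -> triangle m <= triangle n.
Proof. induction 1; simpl; lia. Qed.

Lemma pair_triangle x y : pair x y = y + triangle (x + y).
Proof.
  rewrite (Nat.add_comm x y); unfold pair, Cantor.to_nat; f_equal.
Qed.

Lemma computes_triangle k f :
  computes k f -> computes k (fun A xs => triangle (f A xs)).
Proof.
  apply (computes_lift1 k triangle).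
  apply computes_rec1 with (fun n y => S n + y).
  - apply computes_add; [apply computes_S|]; apply computes_nth; lia.
  - reflexivity.
Qed.

Lemma computes_pair k f g :
  computes k f -> computes k g ->
  computes k (fun A xs => pair (f A xs) (g A xs)).
Proof.
  intros Hf Hg.
  apply computes_ext with (fun A xs => g A xs + triangle (f A xs + g A xs)).
  - apply computes_add; [|apply computes_triangle, computes_add]; assumption.
  - intros; symmetry; apply pair_triangle.
Qed.

(** [x + y] is the least [w] such that [pair x y < triangle (S w)]. *)
Lemma computes_psum : computes1 (fun n => pfst n + psnd n).
Proof.
  (* Argument 0 is the candidate [w] and argument 1 the code [n]; the difference vanishes iff
     [S n <= triangle (S w)], that is, [n < triangle (S w)]. *)
  apply computes_min with (fun _ xs => S (nth 1 xs 0) - triangle (S (nth 0 xs 0))).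
  - apply computes_sub; [|apply computes_triangle]; apply computes_S, computes_nth; lia.
  - intros _ xs _; simpl nth.
    set (n := nth 0 xs 0).
    pose proof (pair_triangle (pfst n) (psnd n)) as E; rewrite pair_eta in E.
    split.
    + cbn [triangle]; lia.
    + intros m Hm.
      pose proof (triangle_le (S m) (pfst n + psnd n) ltac:(lia)); lia.
Qed.

(** By [pair_triangle], removing the triangular number of the coordinate sum from the code leaves
    the second coordinate. *)
Lemma computes_psnd k f :
  computes k f -> computes k (fun A xs => psnd (f A xs)).
Proof.
  intros Hf.
  apply computes_ext with
    (fun A xs => f A xs - triangle (pfst (f A xs) + psnd (f A xs))).
  - apply computes_sub; [exact Hf|].
    apply computes_triangle, (computes_lift1 k _ _ computes_psum Hf).
  - intros A xs _.
    pose proof (pair_triangle (pfst (f A xs)) (psnd (f A xs))) as E.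
    rewrite pair_eta in E; lia.
Qed.

Lemma computes_pfst k f :
  computes k f -> computes k (fun A xs => pfst (f A xs)).
Proof.
  intros Hf.
  apply computes_ext with (fun A xs => pfst (f A xs) + psnd (f A xs) - psnd (f A xs)).
  - apply computes_sub; [|apply computes_psnd, Hf].
    exact (computes_lift1 k _ _ computes_psum Hf).
  - intros; lia.
Qed.

(** Dispatching on the head symbol is needed: up to conversion, [Nat.odd] or [orb] also match
    the conclusion of [computes_if]. *)
Ltac computability :=
  repeat
    match goal with
    | |- computes _ (fun A xs => Nat.b2n (if _ then _ else _)) => apply computes_if
    | |- computes _ (fun A xs => Nat.b2n (_ || _)) => apply computes_orb
    | |- computes _ (fun A xs => Nat.b2n (_ && _)) => apply computes_andb
    | |- computes _ (fun A xs => Nat.b2n (_ =? _)) => apply computes_eqb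
    | |- computes _ (fun A xs => Nat.b2n (_ <? _)) => apply computes_ltb
    | |- computes _ (fun A xs => Nat.b2n (Nat.odd _)) => apply computes_odd
    | |- computes _ (fun A xs => Nat.b2n (A _)) => apply computes_oracle
    | |- computes _ (fun A xs => 2 * _) => apply computes_double
    | |- computes _ (fun A xs => _ + _) => apply computes_add
    | |- computes _ (fun A xs => pair _ _) => apply computes_pair
    | |- computes _ (fun A xs => pfst _) => apply computes_pfst
    | |- computes _ (fun A xs => psnd _) => apply computes_psnd
    | |- computes _ (fun A xs => Nat.div2 _) => apply computes_div2
    | |- computes _ (fun A xs => nth _ xs 0) => apply computes_nth; lia
    | |- computes _ (fun A xs => _) => apply computes_const
    end.

(** * Coding two sets as one *)

Definition join (V E : cantor) : cantor :=
  fun n => if Nat.odd n then E (Nat.div2 n) else V (Nat.div2 n).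

(** Stated as an equality of functions, so that it can be rewritten inside an arbitrary problem. *)
Lemma left_part_join V E : left_part (join V E) = V.
Proof.
  apply functional_extensionality; intros n.
  unfold left_part, join; rewrite Nat.odd_even, Nat.div2_double; reflexivity.
Qed.

Lemma right_part_join V E : right_part (join V E) = E.
Proof.
  apply functional_extensionality; intros n.
  unfold right_part, join; rewrite Nat.odd_odd, Nat.add_1_r, Nat.div2_succ_double.
  reflexivity.
Qed.

(** * Paths *)

(** Peeling off the last edge of an indexed path matches the constructor [rtn1_trans]; the closure
    gives induction on paths. *)
Lemma path_connected_iff G x y :
  path_connected G x y <-> clos_refl_trans_n1 nat (adjacent G) x y.
Proof.
  split.
  - intros (k & p & <- & <- & Hp).
    induction k as [|k IH]; [constructor|].
    apply Relation_Operators.rtn1_trans with (p k).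
    + apply Hp; lia.
    + apply IH; intros i Hi; apply Hp; lia.
  - induction 1 as [|y z Hyz _ (k & p & H0 & Hk & Hp)].
    + exists 0, (fun _ => x); repeat split; lia.
    (* The old path is kept up to index [k], and the new endpoint [z] fills all later indices. *)
    + exists (S k), (fun i => if i <=? k then p i else z); repeat split.
      * exact H0.
      * now rewrite (proj2 (Nat.leb_gt _ _)) by lia.
      * intros i Hi.
        rewrite (proj2 (Nat.leb_le i k)) by lia.
        destruct (Nat.leb_spec (S i) k).
        -- apply Hp; lia.
        -- replace i with k by lia; rewrite Hk; exact Hyz.
Qed.

Lemma path_connected_refl G x : path_connected G x x.
Proof. apply path_connected_iff; constructor. Qed.

Lemma path_connected_trans G x y z :
  path_connected G x y -> path_connected G y z -> path_connected G x z.
Proof.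
  rewrite !path_connected_iff; intros Hxy Hyz.
  apply clos_rt_rtn1; apply rt_trans with y; apply clos_rtn1_rt; assumption.
Qed.

(** Edges may go to paths, not only to edges: a projection of the product collapses some edges to a
    single vertex. *)
Lemma path_connected_map G H (h : nat -> nat) :
  (forall x y, adjacent G x y -> path_connected H (h x) (h y)) ->
  forall x y, path_connected G x y -> path_connected H (h x) (h y).
Proof.
  intros Hh x y Hxy; apply path_connected_iff in Hxy.
  induction Hxy as [|y z Hyz _ IH].
  - apply path_connected_refl.
  - exact (path_connected_trans _ _ _ _ IH (Hh _ _ Hyz)).
Qed.

Lemma adjacent_path_connected G x y : adjacent G x y -> path_connected G x y.
Proof.
  intros H; apply path_connected_iff; apply Relation_Operators.rtn1_trans with x; [exact H|constructor].
Qed.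

Lemma adjacent_vertex G x y :
  is_graph G -> adjacent G x y -> vertex G x /\ vertex G y.
Proof. intros [_ HE] [H|H]; apply HE in H; tauto. Qed.

Lemma adjacent_neq G x y : is_graph G -> adjacent G x y -> x <> y.
Proof. intros [_ HE] [H|H]; apply HE in H; lia. Qed.

Lemma adjacent_sym G x y : adjacent G x y -> adjacent G y x.
Proof. unfold adjacent; tauto. Qed.

(** * The Cartesian product of two graphs *)

Definition adjacentb (G : cantor) (x y : nat) : bool :=
  right_part G (pair x y) || right_part G (pair y x).

Lemma adjacentb_iff G x y : adjacentb G x y = true <-> adjacent G x y.
Proof. apply orb_true_iff. Qed.

(** The fixed coordinate is tested for being a vertex, so that both ends of a product edge are
    vertices of the product. *)
Definition prod_adjacentb (G H : cantor) (a b : nat) : bool :=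
  (pfst a =? pfst b) && left_part G (pfst a) && adjacentb H (psnd a) (psnd b) ||
  (psnd a =? psnd b) && left_part H (psnd a) && adjacentb G (pfst a) (pfst b).

(** Pairing occurs at two levels: a vertex codes a pair, and an edge codes a pair of such codes,
    smaller one first as [is_graph] demands. *)
Definition prod_graph (G H : cantor) : cantor :=
  join (fun a => left_part G (pfst a) && left_part H (psnd a))
       (fun n => (pfst n <? psnd n) && prod_adjacentb G H (pfst n) (psnd n)).

Lemma prod_vertex G H a :
  vertex (prod_graph G H) a <-> vertex G (pfst a) /\ vertex H (psnd a).
Proof.
  unfold vertex at 1, prod_graph; rewrite left_part_join; apply andb_true_iff.
Qed.

Lemma prod_edge_code G H a b :
  edge_code (prod_graph G H) a b <-> a < b /\ prod_adjacentb G H a b = true.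
Proof.
  unfold edge_code, prod_graph; fold (pair a b).
  rewrite right_part_join, pfst_pair, psnd_pair, andb_true_iff, Nat.ltb_lt.
  reflexivity.
Qed.

Lemma prod_adjacentb_iff G H a b :
  prod_adjacentb G H a b = true <->
  (pfst a = pfst b /\ vertex G (pfst a) /\ adjacent H (psnd a) (psnd b)) \/
  (psnd a = psnd b /\ vertex H (psnd a) /\ adjacent G (pfst a) (pfst b)).
Proof.
  unfold prod_adjacentb, vertex.
  rewrite orb_true_iff, !andb_true_iff, !Nat.eqb_eq, !adjacentb_iff; tauto.
Qed.

(** Listing each edge only in increasing order loses nothing, because the product relation is
    symmetric and has no loops. *)
Lemma prod_adjacent G H a b :
  is_graph G -> is_graph H ->
  adjacent (prod_graph G H) a b <-> prod_adjacentb G H a b = true.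
Proof.
  intros HG HH; unfold adjacent at 1; rewrite !prod_edge_code.
  assert (Hsym : forall c d, prod_adjacentb G H c d = true -> prod_adjacentb G H d c = true).
  { intros c d; rewrite !prod_adjacentb_iff.
    intros [(E & HV & Had)|(E & HV & Had)]; [left|right]; rewrite <- E;
      auto using adjacent_sym. }
  split; [intros [[_ Hab]|[_ Hab]]; auto|].
  intros Hab.
  assert (a <> b).
  { intros <-; apply prod_adjacentb_iff in Hab.
    destruct Hab as [(_ & _ & Had)|(_ & _ & Had)];
      apply adjacent_neq in Had; auto. }
  destruct (Nat.lt_total a b) as [|[|]]; auto; tauto.
Qed.

(** For infinity, fix a vertex [y] of [H] and let [x] grow in [G]: the code [pair x y] is at least
    [x]. *)
Lemma prod_is_graph G H :
  is_graph G -> is_graph H -> is_graph (prod_graph G H).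
Proof.
  intros HG HH; split.
  - intros n.
    destruct (proj1 HG n) as (x & Hx & Vx), (proj1 HH 0) as (y & _ & Vy).
    exists (pair x y); split.
    + pose proof (Cantor.to_nat_non_decreasing x y); unfold pair; lia.
    + apply prod_vertex; now rewrite pfst_pair, psnd_pair.
  - intros a b Hab; apply prod_edge_code in Hab; destruct Hab as [Hlt Hab].
    split; [exact Hlt|].
    rewrite !prod_vertex.
    apply prod_adjacentb_iff in Hab.
    destruct Hab as [(<- & HV & Had)|(<- & HV & Had)];
      apply adjacent_vertex in Had; tauto.
Qed.

(** Projections turn product edges into edges or single vertices. Conversely, move first in [G] at
    height [psnd a], then in [H] above [pfst b]; the vertex hypotheses make these two fixed
    coordinates legitimate. *)
Lemma prod_path_connected G H a b :
  is_graph G -> is_graph H -> vertex G (pfst b) -> vertex H (psnd a) ->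
  path_connected (prod_graph G H) a b <->
  path_connected G (pfst a) (pfst b) /\ path_connected H (psnd a) (psnd b).
Proof.
  intros HG HH Vb Va; split.
  - clear Va Vb; intros Hab; split; revert a b Hab;
      apply path_connected_map; intros a b Hab;
      apply prod_adjacent, prod_adjacentb_iff in Hab; trivial;
      destruct Hab as [(E & _ & Had)|(E & _ & Had)];
      solve [apply adjacent_path_connected, Had | rewrite E; apply path_connected_refl].
  - intros [HP HQ].
    rewrite <- (pair_eta a), <- (pair_eta b).
    (* The corner where the horizontal and the vertical path meet. *)
    apply path_connected_trans with (pair (pfst b) (psnd a)).
    + revert HP; apply (path_connected_map G _ (fun x => pair x (psnd a))).
      intros x y Hxy; apply adjacent_path_connected, prod_adjacent; trivial.
      apply prod_adjacentb_iff; rewrite !pfst_pair, !psnd_pair; auto.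
    + revert HQ; apply (path_connected_map H _ (fun y => pair (pfst b) y)).
      intros x y Hxy; apply adjacent_path_connected, prod_adjacent; trivial.
      apply prod_adjacentb_iff; rewrite !pfst_pair, !psnd_pair; auto.
Qed.

(** * Components of the product *)

Lemma path_connected_vertex G x y :
  is_graph G -> vertex G x -> path_connected G x y -> vertex G y.
Proof.
  intros HG Vx Hxy; apply path_connected_iff in Hxy.
  induction Hxy as [|y z Hyz]; [exact Vx|].
  apply (adjacent_vertex _ _ _ HG Hyz).
Qed.

Lemma prod_component G H C1 C2 :
  is_graph G -> is_graph H -> is_component G C1 -> is_component H C2 ->
  is_component (prod_graph G H) (fun a => C1 (pfst a) && C2 (psnd a)).
Proof.
  intros HG HH ((x & Hx) & HV1 & HP1 & Hcl1) ((y & Hy) & HV2 & HP2 & Hcl2).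
  split; [|split; [|split]].
  - exists (pair x y); now rewrite pfst_pair, psnd_pair, Hx, Hy.
  - intros a Ha; apply andb_true_iff in Ha; apply prod_vertex; intuition.
  - intros a b Ha Hb; apply andb_true_iff in Ha, Hb.
    apply prod_path_connected; intuition.
  - intros a b Ha Hab; apply andb_true_iff in Ha; apply andb_true_iff.
    (* [prod_path_connected] needs the first coordinate of [b] to be a vertex; this is carried from
       [a] along the path. *)
    assert (Vb : vertex (prod_graph G H) b).
    { apply path_connected_vertex with a; trivial.
      - now apply prod_is_graph.
      - apply prod_vertex; intuition. }
    apply prod_vertex in Vb.
    apply prod_path_connected in Hab; intuition eauto.
Qed.

(** Points of the section share their second coordinate, so connection in the product amounts to
    connection of the first coordinates in [G]. *)
Lemma prod_component_left G H C c :
  is_graph G -> is_graph H -> is_component (prod_graph G H) C -> C c = true ->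
  is_component G (fun x => C (pair x (psnd c))).
Proof.
  intros HG HH (_ & HV & HP & Hcl) Hc.
  assert (Vc : vertex H (psnd c)) by (apply HV, prod_vertex in Hc; tauto).
  assert (V : forall x, C (pair x (psnd c)) = true -> vertex G x).
  { intros x Hx; apply HV, prod_vertex in Hx; rewrite pfst_pair in Hx; tauto. }
  split; [|split; [|split]].
  - exists (pfst c); now rewrite pair_eta.
  - exact V.
  - intros x y Hx Hy; pose proof (HP _ _ Hx Hy) as Hxy.
    apply prod_path_connected in Hxy; rewrite ?pfst_pair, ?psnd_pair in *; auto.
    tauto.
  - intros x y Hx Hxy; apply Hcl with (1 := Hx).
    apply prod_path_connected; rewrite ?pfst_pair, ?psnd_pair; auto.
    (* The endpoint [y] is not yet known to lie in the section, so it is a vertex only by way of the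
       path from [x]. *)
    + apply path_connected_vertex with x; auto.
    + split; [exact Hxy|apply path_connected_refl].
Qed.

Lemma prod_component_right G H C c :
  is_graph G -> is_graph H -> is_component (prod_graph G H) C -> C c = true ->
  is_component H (fun y => C (pair (pfst c) y)).
Proof.
  intros HG HH (_ & HV & HP & Hcl) Hc.
  assert (Vc : vertex G (pfst c)) by (apply HV, prod_vertex in Hc; tauto).
  assert (V : forall y, C (pair (pfst c) y) = true -> vertex H y).
  { intros y Hy; apply HV, prod_vertex in Hy; rewrite psnd_pair in Hy; tauto. }
  split; [|split; [|split]].
  - exists (psnd c); now rewrite pair_eta.
  - exact V.
  - intros x y Hx Hy; pose proof (HP _ _ Hx Hy) as Hxy.
    apply prod_path_connected in Hxy; rewrite ?pfst_pair, ?psnd_pair in *; auto.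
    tauto.
  - intros x y Hx Hxy; apply Hcl with (1 := Hx).
    apply prod_path_connected; rewrite ?pfst_pair, ?psnd_pair; auto.
    split; [apply path_connected_refl|exact Hxy].
Qed.

(** * The reductions *)

(** Unbounded search finds the least element [c] of a nonempty set uniformly. On the empty set it
    diverges, so it falls outside the total notion [computes]. *)
Lemma computes_search (F : cantor -> nat -> cantor) :
  computes 2 (fun A xs => Nat.b2n (F A (nth 0 xs 0) (nth 1 xs 0))) ->
  exists e, forall A, (exists n, A n = true) ->
    exists c, A c = true /\ maps e A (F A c).
Proof.
  intros [e He].
  (* The arity is 2 because [Min] puts the candidate in front of the input [n], which the test
     ignores. *)
  destruct (computes_negb 2 (fun A xs => A (nth 0 xs 0))) as [d Hd].
  { computability. }
  exists (Comp e [Min d; Proj 0]); intros A HA.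
  destruct (dec_inh_nat_subset_has_unique_least_element (fun n => A n = true))
    as (c & (Hc & Hleast) & _).
  - intros n; destruct (A n); auto.
  - exact HA.
  - exists c; split; [exact Hc|]; intros n.
    apply eval_Comp with [c; n]; [|exact (He A [c; n] eq_refl)].
    constructor; [|repeat constructor].
    constructor.
    + pose proof (Hd A [c; n] eq_refl) as E; simpl in E.
      rewrite Hc in E; exact E.
    (* Below the least element the test returns 1, the successor of 0. *)
    + intros m Hm; exists 0.
      pose proof (Hd A [m; n] eq_refl) as E; simpl in E.
      destruct (A m) eqn:Am; [|exact E].
      apply Hleast in Am; lia.
Qed.

(** Duplicate the graph and keep the first of the two components returned. *)
Lemma P_le_parallel : sW_le P (parallel P P).
Proof.
  destruct (computes_maps (fun A => join A A)) as [phi Hphi].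
  { unfold join; computability. }
  destruct (computes_maps left_part) as [psi Hpsi].
  { unfold left_part; computability. }
  exists phi, psi; intros A (T & HT).
  exists (join A A); unfold instance, parallel.
  rewrite left_part_join, right_part_join.
  split; [apply Hphi|split].
  - exists (join T T); rewrite left_part_join, right_part_join; auto.
  - intros S [HS _]; exists (left_part S); auto.
Qed.

Lemma parallel_le_P : sW_le (parallel P P) P.
Proof.
  destruct (computes_maps (fun A => prod_graph (left_part A) (right_part A)))
    as [phi Hphi].
  { unfold prod_graph, prod_adjacentb, adjacentb, join, left_part, right_part.
    computability. }
  destruct (computes_search (fun C c =>
    join (fun x => C (pair x (psnd c))) (fun y => C (pair (pfst c) y))))
    as [psi Hpsi].
  { unfold join; computability. }
  exists phi, psi; intros A (T & [HG1 HT1] & [HG2 HT2]).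
  exists (prod_graph (left_part A) (right_part A)).
  split; [apply Hphi|split].
  (* Being an instance of [P] includes solvability; the product of the two components contained in
     [T] is a solution. *)
  - eexists; split; [now apply prod_is_graph|].
    eapply prod_component; eassumption.
  - intros C [_ HC].
    (* Components are nonempty, so the search through [C] halts. *)
    destruct (Hpsi C (proj1 HC)) as (c & Hc & Hmaps).
    eexists; split; [exact Hmaps|].
    unfold parallel; rewrite left_part_join, right_part_join.
    split; (split; [assumption|]).
    + eapply prod_component_left; eassumption.
    + now apply (prod_component_right (left_part A) (right_part A)).
Qed.

Theorem theorem6p2 : sW_equiv P (parallel P P).
Proof. split; [apply P_le_parallel|apply parallel_le_P]. Qed.
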